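(* There is some $n_0 \in \mathbb{N}$ such that for every integer $n \ge n_0$ and every family $\mathcal{F} \subseteq 2^{[n]}$, the number of $(3,2)$-colourings of $\mathcal{F}$ is at most $3^{\binom{n}{\lfloor n/2 \rfloor}}$. Moreover, we have equality if and only if $\mathcal{F} = \binom{[n]}{\lfloor n/2 \rfloor}$ or $\mathcal{F} = \binom{[n]}{\lceil n/2 \rceil}$.
   Context: $[n] = \{1,\dots,n\}$, $2^{[n]}$ is the family of all subsets of $[n]$, and $\binom{[n]}{j}$ is the family of all $j$-element subsets of $[n]$. A $k$-chain is a collection of $k$ distinct sets $F_1 \subset F_2 \subset \cdots \subset F_k$ (strict containments). Given a family $\mathcal{F} \subseteq 2^{[n]}$, an $(r,k)$-colouring of $\mathcal{F}$ is an $r$-colouring of the sets in $\mathcal{F}$ (that is, a map from $\mathcal{F}$ to a fixed set of $r$ colours, not necessarily surjective) such that there is no monochromatic $k$-chain consisting of members of $\mathcal{F}$. Thus in a $(3,2)$-colouring three colours are used and each colour class is an antichain. *)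

(* Defs.v *)
From mathcomp Require Import all_boot.

Set Implicit Arguments.
Unset Strict Implicit.
Unset Printing Implicit Defensive.

(* The ground set [n] is represented by 'I_n = {0, ..., n-1}. *)

Definition layer (n j : nat) : {set {set 'I_n}} := [set X : {set 'I_n} | #|X| == j].

(* [proper] is transitive, so a sorted sequence is a strictly increasing chain. *)
Definition is_chain (n : nat) (s : seq {set 'I_n}) : bool :=
  sorted (fun A B : {set 'I_n} => A \proper B) s.

Definition members (n : nat) (F : {set {set 'I_n}}) : finType :=
  {X : {set 'I_n} | X \in F}.

(* Colours are assigned to the members of F only, so that distinct elements of
   the function type are distinct maps on F. *)
Definition is_colouring (n r k : nat) (F : {set {set 'I_n}})
    (c : {ffun members F -> 'I_r}) : bool :=
  [forall t : k.-tuple (members F),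
     is_chain [seq val A | A <- t] ==> ~~ constant [seq c A | A <- t]].

Definition colourings (n r k : nat) (F : {set {set 'I_n}}) :
    {set {ffun members F -> 'I_r}} :=
  [set c | is_colouring k c].
Arguments colourings {n} r k F.

(* Main.v *)
Require Import Defs.
From mathcomp Require Import all_boot fingroup perm zify.

(** Two members of F are adjacent when one contains the other, so a
    (3,2)-colouring of F is a proper 3-colouring of this graph. Write N for the
    middle binomial coefficient and m for the number of non-isolated members of
    F. If m = 0 then F is an antichain with exactly 3 ^ #|F| colourings, and the
    claim is Sperner's theorem with its equality case. If m > 0, the number of
    colourings turns out to be smaller than 3 ^ N.

    For m > 0 the colourings are counted with lists of admissible colours.
    While some vertex v has a colour i in its list and at least Delta neighbours
    with i in their lists, split the colourings according to whether v receives
    i: either i leaves the list of v, or it leaves the lists of these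
    neighbours. If q ^ Delta <= (q + 1) ^ (Delta - 1), the whole branching costs
    a factor at most ((q + 1) / q) ^ s, where s is the total size of the lists
    of the non-isolated vertices, initially 3 m
    ([list_colourings_branching]).

    At a leaf, each colour i is available on a family A_i in which all degrees
    are smaller than Delta. Two facts bound the number of colourings there.

    - [sparse_members_size]: such families satisfy D #|A_i| <= D N + 2 m when
      D Delta <= n. On a uniformly random maximal chain, the number of members
      of A_i exceeds 1 by at most the number of comparable pairs on the chain,
      and a pair of comparable sets, neither empty nor full, lies on the chain
      with probability at most 2 / n times the sum of the probabilities that
      its two members do.

    - [list_colourings_sixth_power]: if S is the total size of the lists, the
      number of colourings is at most 3 ^ (S / 3) times (8 / 9) ^ (m / 6). A
      list of size 1 or 2 already falls short of the bound 3 ^ (size / 3), and a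
      list of size 3 loses a colour as soon as a neighbour is coloured; colouring
      first the vertices of a maximal independent set, or first the others,
      yields such a loss on at least m / 2 vertices.

    Together, the number c of colourings satisfies
    (c / 3 ^ N) ^ (6 D) <= (3 ^ 12 (8 / 9) ^ D ((q + 1) / q) ^ (18 D)) ^ m,
    and the right-hand side is less than 1 for D = 120 and q = 36 D. The
    condition on q and Delta then holds with Delta = n / D once n is at least
    D (q ^ 2 + 1). *)

Set Implicit Arguments.
Unset Strict Implicit.
Unset Printing Implicit Defensive.

(** * Proper list colourings of a graph *)

Lemma leq_card_bigcup (I T : finType) (A : {set I}) (B : I -> {set T}) :
  #|\bigcup_(i in A) B i| <= \sum_(i in A) #|B i|.
Proof.
elim/big_rec2: _ => [|i n U _ leUn]; first by rewrite cards0.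
by apply: leq_trans (leq_card_setU _ _) _; rewrite leq_add2l.
Qed.

Lemma leq_expn2r k a b : a <= b -> a ^ k <= b ^ k.
Proof. by move=> le_ab; case: k => // k; rewrite leq_exp2r. Qed.

Section ListColourings.

Variables (V : finType) (e : rel V).
Hypotheses (e_sym : symmetric e) (e_irr : irreflexive e).

Implicit Types (L : {ffun V -> {set 'I_3}}) (W : {set V}).

(** The proper colourings of the graph [e] that give each vertex [v] a colour
    from its list [L v]. *)
Definition list_colourings L : {set {ffun V -> 'I_3}} :=
  [set c : {ffun V -> 'I_3} | [forall v, c v \in L v] &&
           [forall u, forall v, e u v ==> (c u != c v)]].

(** The total size of the lists of the vertices in [W]. *)
Definition list_total W L := \sum_(v in W) #|L v|.

Definition nonisolated : {set V} := [set v | [exists u, e v u]].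

Lemma list_colouringsP L (c : {ffun V -> 'I_3}) :
  reflect ((forall v, c v \in L v) /\ (forall u v, e u v -> c u != c v))
          (c \in list_colourings L).
Proof.
rewrite inE; apply: (iffP andP) => -[cL cP]; split; try exact/forallP.
  by move=> u v; move/forallP: cP => /(_ u)/forallP/(_ v)/implyP.
by apply/forallP => u; apply/forallP => v; apply/implyP; apply: cP.
Qed.

Lemma card_product_lists L :
  #|[set c : {ffun V -> 'I_3} | [forall v, c v \in L v]]| = \prod_v #|L v|.
Proof.
transitivity #|family (fun v => mem (L v))|.
  by apply: eq_card => c; rewrite inE; apply/forallP/familyP.
by rewrite card_family foldrE big_map big_enum.
Qed.

(** The number of colours left in a list of size [k] once a neighbour is known to
    have some colour, the worst case being taken when [k < 3]. *)
Definition reduced_size (k : nat) := if k == 3 then 2 else k.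

(** Colour the vertices outside [W] first: a vertex of [W] whose list is full has
    then lost the colour of its neighbour outside [W]. *)
Lemma card_list_colourings_dominated L W :
    (forall w, w \in W -> exists2 u, u \notin W & e w u) ->
  #|list_colourings L| <=
    \prod_v (if v \in W then reduced_size #|L v| else #|L v|).
Proof.
move=> domW.
(* A neighbour of [w] outside [W]. *)
pose nu w := odflt w [pick u | (u \notin W) && e w u].
have nuP w : w \in W -> (nu w \notin W) /\ e w (nu w).
  move=> /domW[u uW ewu]; rewrite /nu; case: pickP => [x /andP[] //|/(_ u)].
  by rewrite uW ewu.
pose restr (c : {ffun V -> 'I_3}) := [ffun v => if v \in W then ord0 else c v].
pose L0 := [ffun v => if v \in W then [set ord0] else L v].
pose R := [set c : {ffun V -> 'I_3} | [forall v, c v \in L0 v]].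
pose L1 (r : {ffun V -> 'I_3}) :=
  [ffun v => if v \in W then L v :\ r (nu v) else [set r v]].
(* The colourings are grouped by their restriction to the complement of [W]. *)
have sub : list_colourings L \subset
    \bigcup_(r in R) [set c : {ffun V -> 'I_3} | [forall v, c v \in L1 r v]].
  apply/subsetP => c /list_colouringsP[cL cP].
  apply/bigcupP; exists (restr c).
    rewrite inE; apply/forallP => v; rewrite !ffunE.
    by case: ifP => _; [rewrite set11 | exact: cL].
  rewrite inE; apply/forallP => v; rewrite ffunE.
  case: ifP => vW; last by rewrite ffunE vW set11.
  have [nW nE] := nuP v vW.
  by rewrite ffunE (negbTE nW) !inE cL andbT cP.
apply: (leq_trans (subset_leq_card sub)).
apply: (leq_trans (leq_card_bigcup _ _)).
have bound r : r \in R -> #|[set c : {ffun V -> 'I_3} | [forall v, c v \in L1 r v]]|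
    <= \prod_v (if v \in W then reduced_size #|L v| else 1).
  move=> _; rewrite card_product_lists; apply: leq_prod => v _; rewrite ffunE.
  case: ifP => vW; last by rewrite cards1.
  rewrite /reduced_size; case: eqP => [L3|_].
    have /eqP -> : L v == setT by rewrite eqEcard subsetT cardsT card_ord L3.
    by rewrite cardsDS ?subsetT // cardsT card_ord cards1.
  by apply: subset_leq_card; apply: subD1set.
apply: leq_trans; first exact: (leq_sum _ bound).
rewrite sum_nat_const card_product_lists -big_split /=.
by apply: leq_prod => v _; rewrite ffunE; case: ifP => _; rewrite ?cards1 ?mul1n ?muln1.
Qed.

(** The estimate is vertexwise: [k ^ 3 <= 3 ^ k] for every list size [k <= 3], and
    [9 * (reduced_size k) ^ 3 <= 8 * 3 ^ k]. *)
Lemma list_colourings_dominated L W :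
    (forall w, w \in W -> exists2 u, u \notin W & e w u) ->
  #|list_colourings L| ^ 3 * 9 ^ #|W| <= 3 ^ (list_total setT L) * 8 ^ #|W|.
Proof.
move=> domW.
have le3 (A : {set 'I_3}) : #|A| <= 3 by rewrite -[leqRHS]card_ord max_card.
pose f v := if v \in W then reduced_size #|L v| else #|L v|.
have cardW k : k ^ #|W| = \prod_v (if v \in W then k else 1).
  by rewrite -big_mkcond prod_nat_const.
apply: (@leq_trans ((\prod_v f v) ^ 3 * 9 ^ #|W|)).
  by rewrite leq_mul2r leq_exp2r ?card_list_colourings_dominated ?orbT.
have -> : (\prod_v f v) ^ 3 = \prod_v (f v ^ 3).
  by rewrite !expnS expn0 muln1 -!big_split /=.
have -> : list_total setT L = \sum_v #|L v|.
  by apply: eq_bigl => v; rewrite inE.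
rewrite expn_sum !cardW -!big_split /=; apply: leq_prod => v _.
rewrite /f /reduced_size; have := le3 (L v).
by case: (v \in W); case: (#|L v|) => [|[|[|[|k]]]].
Qed.

(** For a maximal independent set [I], both the complement of [I] and the
    non-isolated part of [I] can be coloured last, and together they contain each
    non-isolated vertex exactly once. *)
Lemma list_colourings_sixth_power L :
  #|list_colourings L| ^ 6 * 9 ^ #|nonisolated| <=
    3 ^ (2 * list_total setT L) * 8 ^ #|nonisolated|.
Proof.
pose indep (I : {set V}) := [forall u in I, forall v in I, ~~ e u v].
have [I maxI] : {I | maxset indep I}.
  have P0 : indep set0 by apply/forall_inP => u; rewrite inE.
  by have [I mI _] := maxset_exists P0; exists I.
have indI u v : u \in I -> v \in I -> ~~ e u v.
  have /maxsetP[/forall_inP h _] := maxI.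
  by move=> uI; move/(_ u uI): h => /forall_inP; apply.
have domI u : u \notin I -> exists2 v, v \in I & e u v.
  move=> uI; apply/exists_inP; rewrite -[X in is_true X]negbK; apply/negP.
  rewrite negb_exists_in => /forall_inP nadj.
  have [_ mI] := maxsetP maxI.
  have : u |: I = I.
    apply: mI; last exact: subsetUr.
    apply/forall_inP => x /setU1P[->|xI]; apply/forall_inP => y /setU1P[->|yI].
    - by rewrite e_irr.
    - exact: nadj.
    - by rewrite e_sym; apply: nadj.
    - exact: indI.
  by move=> eI; rewrite -eI setU11 in uI.
have dom1 w : w \in ~: I -> exists2 u, u \notin ~: I & e w u.
  by rewrite inE => /domI[u uI ewu]; exists u; rewrite // inE negbK.
have dom2 w : w \in nonisolated :&: I ->
    exists2 u, u \notin nonisolated :&: I & e w u.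
  rewrite !inE => /andP[/existsP[u ewu] wI]; exists u => //.
  rewrite inE negb_and; apply/orP; right; apply/negP => uI.
  by have := indI _ _ wI uI; rewrite ewu.
have cardJ : #|nonisolated| = #|~: I| + #|nonisolated :&: I|.
  rewrite -(cardsID I nonisolated) addnC; congr (_ + _).
  apply: eq_card => v; rewrite !inE andbC; case vI : (v \in I); rewrite ?andbF //=.
  have [u _ evu] := domI v (negbT vI).
  by rewrite andbT; apply/existsP; exists u.
have := leq_mul (list_colourings_dominated L dom1) (list_colourings_dominated L dom2).
by rewrite cardJ mulnACA [X in _ <= X]mulnACA -!expnD mul2n -addnn.
Qed.

(** The vertices on which the colour [i] is available. *)
Definition palette L (i : 'I_3) : {set V} := [set v | i \in L v].

Lemma list_total_palettes L : list_total setT L = \sum_i #|palette L i|.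
Proof.
have cardE (I T : finType) (A : I -> {set T}) i :
    #|A i| = \sum_x (x \in A i : nat).
  by rewrite -sum1_card big_mkcond; apply: eq_bigr => x _; case: (x \in A i).
rewrite /list_total (eq_bigl xpredT); last by move=> v; rewrite inE.
rewrite (eq_bigr _ (fun v _ => cardE _ _ L v)) exchange_big /=.
apply: eq_bigr => i _; rewrite (cardE _ _ (palette L)).
by apply: eq_bigr => v _; rewrite inE.
Qed.

(** The neighbours of [v] that lose the colour [i] when [v] receives it. *)
Definition conflicts L i v : {set V} := [set u in palette L i | e v u].

(** The lists of the colourings in which [v] does not have the colour [i]. *)
Definition forbid L i v : {ffun V -> {set 'I_3}} :=
  [ffun u => if u == v then L u :\ i else L u].

(** Lists that contain every colouring in which [v] has the colour [i]. The list
    of [v] itself is kept, since only the loss at the neighbours is used. *)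
Definition assign L i v : {ffun V -> {set 'I_3}} :=
  [ffun u => if e v u then L u :\ i else L u].

Lemma list_colourings_branch L i v :
  #|list_colourings L| <=
    #|list_colourings (forbid L i v)| + #|list_colourings (assign L i v)|.
Proof.
apply: leq_trans (leq_card_setU _ _); apply: subset_leq_card.
apply/subsetP => c /list_colouringsP[cL cP]; rewrite inE; apply/orP.
have [cvi|cvi] := eqVneq (c v) i; [right|left]; apply/list_colouringsP.
  split=> // u; rewrite ffunE; case: ifP => // evu.
  by rewrite !inE cL andbT eq_sym -cvi cP.
split=> // u; rewrite ffunE; case: ifP => // /eqP ->.
by rewrite !inE cvi cL.
Qed.

Lemma list_total_forbid L i v : v \in nonisolated -> i \in L v ->
  list_total nonisolated L = (list_total nonisolated (forbid L i v)).+1.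
Proof.
move=> vJ iLv; rewrite /list_total !(bigD1 v vJ) /= ffunE eqxx.
rewrite (cardsD1 i (L v)) iLv add1n addSn; congr (_ + _).+1.
by apply: eq_bigr => u /andP[_ uv]; rewrite ffunE (negbTE uv).
Qed.

Lemma list_total_assign L i v :
  list_total nonisolated L =
    list_total nonisolated (assign L i v) + #|conflicts L i v|.
Proof.
have -> : #|conflicts L i v| = \sum_(u in nonisolated) (e v u && (i \in L u)).
  rewrite -sum1_card big_mkcond [RHS]big_mkcond /=; apply: eq_bigr => u _.
  rewrite !inE; case evu: (e v u); rewrite ?andbF ?if_same //= andbT.
  have -> : [exists w, e u w] by apply/existsP; exists v; rewrite e_sym.
  by case: (i \in L u).
rewrite -big_split /=; apply: eq_bigr => u _; rewrite ffunE.
by case: (e v u); rewrite ?addn0 // [LHS](cardsD1 i) addnC.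
Qed.

Variables (D Delta N q : nat).
Local Notation m := #|nonisolated|.

(** Used for the palettes at the leaves of the branching. *)
Hypothesis sparse_small : forall A : {set V},
  (forall v, v \in A -> #|[set u in A | e v u]| < Delta) ->
  D * #|A| <= D * N + 2 * m.

(** The bound obtained at the leaves of the branching, in integer form:
    [k ^ (6 D) <= 3 ^ (6 D N + 12 m) (8 / 9) ^ (D m)]. *)
Definition leaf_value (k : nat) :=
  k ^ (6 * D) * 9 ^ (D * m) <= 3 ^ (6 * D * N + 12 * m) * 8 ^ (D * m).

Lemma leaf_value_leaf L :
    (forall i v, i \in L v -> #|conflicts L i v| < Delta) ->
  leaf_value #|list_colourings L|.
Proof.
move=> leafL; rewrite /leaf_value.
have DS : D * list_total setT L <= 3 * (D * N + 2 * m).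
  rewrite list_total_palettes big_distrr /=.
  have -> : 3 * (D * N + 2 * m) = \sum_(i < 3) (D * N + 2 * m).
    by rewrite sum_nat_const card_ord.
  apply: leq_sum => i _; apply: sparse_small => v; rewrite inE.
  exact: leafL.
rewrite expnM ![_ ^ (D * m)](expnM _ D) -!expnM ![D * m]mulnC !(expnM _ m).
rewrite (expnM _ 6) -expnMn.
apply: (@leq_trans ((3 ^ (2 * list_total setT L) * 8 ^ m) ^ D)).
  by apply: leq_expn2r; apply: list_colourings_sixth_power.
rewrite expnMn -!expnM leq_mul2r leq_exp2l //; lia.
Qed.

Hypothesis Delta_gt0 : 0 < Delta.
(** This inequality says that [x = (q + 1) / q] satisfies
    [x ^ (s - 1) + x ^ (s - Delta) <= x ^ s], as the branching requires. *)
Hypothesis Delta_large : q ^ Delta <= q.+1 ^ Delta.-1.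

(** The witness [K] is the largest number of colourings at a leaf of the
    branching. *)
Lemma list_colourings_branching L :
  exists2 K, leaf_value K &
    #|list_colourings L| * q ^ list_total nonisolated L <=
      K * q.+1 ^ list_total nonisolated L.
Proof.
have [s] := ubnP (list_total nonisolated L); elim: s L => // s IHs L ltLs.
case: (boolP [exists i, exists v, (i \in L v) && (Delta <= #|conflicts L i v|)]);
  last first.
  move=> leafL; exists #|list_colourings L|.
    apply: leaf_value_leaf => i v iLv; rewrite ltnNge; apply/negP => big.
    by case/negP: leafL; apply/existsP; exists i; apply/existsP; exists v; rewrite iLv.
  by rewrite leq_mul2l leq_expn2r ?orbT.
move=> /existsP[i /existsP[v /andP[iLv big]]].
have vJ : v \in nonisolated.
  have /card_gt0P[u] := leq_trans Delta_gt0 big.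
  by rewrite !inE => /andP[_ evu]; apply/existsP; exists u.
have total1 := list_total_forbid vJ iLv.
have total2 := list_total_assign L i v.
have branch := list_colourings_branch L i v.
set t := list_total nonisolated L in ltLs total1 total2 *.
have [K1 leaf1 le1] := IHs (forbid L i v) ltac:(lia).
have [K2 leaf2 le2] := IHs (assign L i v) ltac:(lia).
set a := #|list_colourings (forbid L i v)| in branch le1.
set b := #|list_colourings (assign L i v)| in branch le2.
set t1 := list_total _ (forbid L i v) in total1 le1.
set t2 := list_total _ (assign L i v) in total2 le2.
pose K := maxn K1 K2.
have leafK : leaf_value K by rewrite /K; case: (leqP K1 K2).
exists K => //.
have le1' : a * q ^ t1 <= K * q.+1 ^ t1.
  by apply: leq_trans le1 _; rewrite leq_mul2r leq_maxl orbT.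
have le2' : b * q ^ (t - Delta) <= K * q.+1 ^ (t - Delta).
  have -> : t - Delta = t2 + (t - Delta - t2) by lia.
  rewrite !expnD !mulnA; apply: leq_mul; last exact: leq_expn2r.
  by apply: leq_trans le2 _; rewrite leq_mul2r leq_maxr orbT.
have Delta_t : Delta <= t by lia.
apply: (@leq_trans ((a + b) * q ^ t)); first by rewrite leq_mul2r branch orbT.
rewrite mulnDl.
apply: (@leq_trans (K * q.+1 ^ t1 * q + K * q.+1 ^ (t - Delta) * q ^ Delta)).
  have -> : a * q ^ t = a * q ^ t1 * q by rewrite total1 expnSr mulnA.
  have -> : b * q ^ t = b * q ^ (t - Delta) * q ^ Delta.
    by rewrite -mulnA -expnD subnK.
  by apply: leq_add; rewrite leq_mul2r ?le1' ?le2' orbT.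
have t1E : t1 = t - Delta + Delta.-1 by lia.
have -> : q.+1 ^ t1 = q.+1 ^ (t - Delta) * q.+1 ^ Delta.-1 by rewrite t1E expnD.
have -> : q.+1 ^ t = q.+1 ^ (t - Delta) * q.+1 ^ Delta.-1 * q.+1.
  by rewrite -expnD -t1E -expnSr -total1.
move: (q.+1 ^ (t - Delta)) (q.+1 ^ Delta.-1) (q ^ Delta) Delta_large => x y z yz.
by rewrite -!mulnA -mulnDr leq_mul2l -mulnDr leq_mul2l mulnSr leq_add2l yz !orbT.
Qed.

Hypothesis D_gt0 : 0 < D.
Hypothesis gain : 3 ^ 12 * 8 ^ D * q.+1 ^ (18 * D) < 9 ^ D * q ^ (18 * D).

Lemma list_colourings_lt : 0 < m ->
  #|list_colourings [ffun => setT]| < 3 ^ N.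
Proof.
move=> m_gt0.
have [K leafK] := list_colourings_branching [ffun => setT].
have -> : list_total nonisolated [ffun => setT] = 3 * m.
  rewrite /list_total; under eq_bigr => v _ do rewrite ffunE cardsT card_ord.
  by rewrite sum_nat_const mulnC.
set c := #|_| => cK.
have D6_gt0 : 0 < 6 * D by rewrite muln_gt0.
have gainm : (3 ^ 12 * 8 ^ D * q.+1 ^ (18 * D)) ^ m < (9 ^ D * q ^ (18 * D)) ^ m.
  by rewrite ltn_exp2r.
rewrite -(ltn_exp2r _ _ D6_gt0) -expnM [N * _]mulnC.
set G := (_ * q ^ _) ^ m in gainm.
have G_gt0 : 0 < G by exact: leq_ltn_trans gainm.
rewrite -(ltn_pmul2r G_gt0).
have pow3_gt0 : 0 < 3 ^ (6 * D * N) by rewrite expn_gt0.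
have := gainm; rewrite -(ltn_pmul2l pow3_gt0); apply: leq_ltn_trans.
have -> : G = 9 ^ (D * m) * q ^ (18 * D * m) by rewrite /G expnMn -!expnM.
rewrite expnMn [(3 ^ 12 * _) ^ _]expnMn -!expnM.
have cK6 : (c * q ^ (3 * m)) ^ (6 * D) <= (K * q.+1 ^ (3 * m)) ^ (6 * D).
  by rewrite leq_exp2r.
have E : 3 * m * (6 * D) = 18 * D * m by lia.
rewrite !expnMn -!expnM E in cK6.
rewrite /leaf_value expnD in leafK.
rewrite mulnCA mulnC.
apply: (@leq_trans (K ^ (6 * D) * q.+1 ^ (18 * D * m) * 9 ^ (D * m))).
  by rewrite leq_mul2r cK6 orbT.
by rewrite mulnAC !mulnA leq_mul2r leafK orbT.
Qed.

End ListColourings.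

(** * Binomial coefficients *)

Lemma leq_bin_interior n k : 0 < k < n -> n <= 'C(n, k).
Proof.
elim: n k => [|n IHn] [|k] //=; rewrite ltnS => kn.
rewrite binS; have [eq_k|ne_k] := eqVneq k.+1 n.
  by rewrite -eq_k binn binSn; lia.
have := IHn k.+1 ltac:(lia); have : 0 < 'C(n, k) by rewrite bin_gt0; lia.
lia.
Qed.

Lemma ltn_bin_half n k : k < n./2 -> 'C(n, k) < 'C(n, n./2).
Proof.
have step j : j < n./2 -> 'C(n, j) < 'C(n, j.+1).
  move=> jn; have := mul_bin_left n j.
  have : 0 < 'C(n, j) by rewrite bin_gt0; lia.
  by nia.
move: {2}(n./2 - k) (erefl (n./2 - k)) => d; elim: d k => [|d IHd] k kd kn.
  by lia.
have [<-|ne_k] := eqVneq k.+1 n./2; first exact: step.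
by apply: ltn_trans (step _ kn) _; apply: IHd; lia.
Qed.

Lemma ltn_bin_off_middle n k :
  k != n./2 -> k != uphalf n -> 'C(n, k) < 'C(n, n./2).
Proof.
move=> k1 k2; case: (leqP k n) => kn; last first.
  by rewrite bin_small // bin_gt0; lia.
case: (ltngtP k n./2) => [|gt_k|eq_k]; first exact: ltn_bin_half.
  by rewrite -bin_sub //; apply: ltn_bin_half; lia.
by rewrite eq_k eqxx in k1.
Qed.

Lemma bin_uphalf n : 'C(n, uphalf n) = 'C(n, n./2).
Proof. by rewrite -bin_sub; [congr 'C(_, _); lia | lia]. Qed.

Lemma leq_bin_half n k : 'C(n, k) <= 'C(n, n./2).
Proof.
have [->//|k1] := eqVneq k n./2; have [->|k2] := eqVneq k (uphalf n).
  by rewrite bin_uphalf.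
exact/ltnW/ltn_bin_off_middle.
Qed.

(** * Families of sets and random maximal chains *)

(** Two distinct sets, one of which contains the other. *)
Definition nested (T : finType) (X Y : {set T}) :=
  (X \proper Y) || (Y \proper X).

Section PermutationChains.

Variable n : nat.

Implicit Types (X Y : {set 'I_n}) (A : {set {set 'I_n}}) (s g : {perm 'I_n}).

(** A permutation [s] stands for the maximal chain formed by the images under [s]
    of the initial segments [{0, ..., k - 1}]. *)
Definition initial k : {set 'I_n} := [set i : 'I_n | i < k].

(** The permutations whose maximal chain passes through [X]. *)
Definition through X : {set {perm 'I_n}} :=
  [set s : {perm 'I_n} | s @: initial #|X| == X].

Lemma card_initial k : k <= n -> #|initial k| = k.
Proof.
move=> kn; have inj : injective (widen_ord kn) by move=> i j [] /val_inj.
rewrite -[RHS](card_ord k) -cardsT -(card_imset _ inj); apply: eq_card => i.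
rewrite !inE; apply/idP/imsetP => [ik|[j _ ->]] //=.
by exists (Ordinal ik) => //; apply: val_inj.
Qed.

Lemma initial_sub j k : j <= k -> initial j \subset initial k.
Proof. by move=> jk; apply/subsetP => i; rewrite !inE => /leq_trans; apply. Qed.

(** Permutations act transitively on the pairs [X \subset Y] of given sizes. *)
Lemma perm_flag X1 Y1 X2 Y2 :
    X1 \subset Y1 -> X2 \subset Y2 -> #|X1| = #|X2| -> #|Y1| = #|Y2| ->
  exists g : {perm 'I_n}, g @: X1 = X2 /\ g @: Y1 = Y2.
Proof.
move=> XY1 XY2 cardX cardY.
(* List [X], then [Y] minus [X], then the rest; the permutation sends the
   entries of one such list to the entries of the other. *)
pose flag X Y := (enum X ++ enum (Y :\: X)) ++ enum (~: Y).
have flag_mem X Y x : x \in flag X Y.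
  by rewrite !mem_cat !mem_enum !inE; case: (x \in X); case: (x \in Y).
have size_fst X Y : X \subset Y -> size (enum X ++ enum (Y :\: X)) = #|Y|.
  by move=> XY; rewrite size_cat -!cardE cardsDS // subnKC // subset_leq_card.
have size_flag X Y : X \subset Y -> size (flag X Y) = n.
  by move=> XY; rewrite size_cat size_fst // -cardE cardsC card_ord.
have flag_uniq X Y : X \subset Y -> uniq (flag X Y).
  move=> XY; apply/card_uniqP; rewrite size_flag // -[RHS]card_ord.
  by apply: eq_card => x; rewrite flag_mem.
pose f x := nth x (flag X2 Y2) (index x (flag X1 Y1)).
have idx x : index x (flag X1 Y1) < size (flag X2 Y2).
  have -> : size (flag X2 Y2) = size (flag X1 Y1) by rewrite !size_flag.
  by rewrite index_mem.
have f_inj : injective f.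
  move=> x y /eqP; rewrite /f (set_nth_default y) // nth_uniq ?flag_uniq // => /eqP eq_i.
  by rewrite -(nth_index x (flag_mem X1 Y1 x)) eq_i nth_index.
exists (perm f_inj).
have imE X : perm f_inj @: X = f @: X by apply: eq_imset => x; rewrite permE.
have eqim (X X' : {set 'I_n}) : #|X| = #|X'| -> (forall x, x \in X -> f x \in X') ->
    f @: X = X'.
  move=> cX sub; apply/eqP; rewrite eqEcard (card_imset _ f_inj) cX leqnn andbT.
  by apply/subsetP => _ /imsetP[x xX ->]; apply: sub.
rewrite !imE; split; apply: eqim => // x.
  move=> xX; have ix : index x (enum X1) < size (enum X2).
    by rewrite -cardE -cardX cardE index_mem mem_enum.
  rewrite /f /flag -!catA index_cat mem_enum xX nth_cat ix -mem_enum.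
  exact: mem_nth.
move=> xY; set p1 := enum X1 ++ enum (Y1 :\: X1); set p2 := enum X2 ++ enum (Y2 :\: X2).
have xp : x \in p1.
  by rewrite mem_cat !mem_enum !inE xY andbT orbN.
have ix : index x p1 < size p2 by rewrite size_fst // -cardY -(size_fst X1) // index_mem.
have : f x \in p2 by rewrite /f /flag index_cat xp nth_cat ix mem_nth.
by rewrite mem_cat !mem_enum inE => /orP[/(subsetP XY2)|/andP[_]].
Qed.

Lemma card_through_flag X1 Y1 X2 Y2 :
    X1 \subset Y1 -> X2 \subset Y2 -> #|X1| = #|X2| -> #|Y1| = #|Y2| ->
  #|through X1 :&: through Y1| = #|through X2 :&: through Y2|.
Proof.
wlog suff le : X1 Y1 X2 Y2 / X1 \subset Y1 -> X2 \subset Y2 -> #|X1| = #|X2| ->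
    #|Y1| = #|Y2| -> #|through X1 :&: through Y1| <= #|through X2 :&: through Y2|.
  by move=> *; apply/eqP; rewrite eqn_leq !le.
move=> XY1 XY2 cardX cardY; have [g [gX gY]] := perm_flag XY1 XY2 cardX cardY.
rewrite -(card_imset _ (mulIg g)); apply: subset_leq_card.
apply/subsetP => _ /imsetP[s + ->]; rewrite !inE => /andP[/eqP sX /eqP sY].
have mulE X : (s * g)%g @: X = g @: (s @: X).
  by rewrite -imset_comp; apply: eq_imset => x; rewrite /= permM.
by rewrite !mulE -cardX -cardY sX sY gX gY !eqxx.
Qed.

Lemma card_through_size X1 X2 : #|X1| = #|X2| -> #|through X1| = #|through X2|.
Proof.
move=> cX; have := card_through_flag (subxx X1) (subxx X2) cX cX.
by rewrite !setIid.
Qed.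

Lemma through_card_imset s k : k <= n -> #|s @: initial k| = k.
Proof. by move=> kn; rewrite (card_imset _ perm_inj) card_initial. Qed.

Lemma card_set_ord X : #|X| <= n.
Proof. by rewrite -[leqRHS]card_ord max_card. Qed.

Lemma card_layer k : #|layer n k| = 'C(n, k).
Proof. by rewrite card_draws card_ord. Qed.

(** Double counting of the pairs of a set and a chain through it. *)
Lemma sum_through (Z : {set {set 'I_n}}) (P : {set {perm 'I_n}}) :
  \sum_(X in Z) #|through X :&: P| = \sum_(s in P) #|[set X in Z | s \in through X]|.
Proof.
under eq_bigr => X _ do rewrite -sum1_card big_mkcond /=.
rewrite exchange_big [RHS]big_mkcond /=; apply: eq_bigr => s _.
case: ifP => sP; last first.
  by apply: big1 => X _; rewrite inE sP andbF.
rewrite -sum1_card [LHS]big_mkcond [RHS]big_mkcond /=.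
by apply: eq_bigr => X _; rewrite !inE sP andbT; case: (X \in Z).
Qed.

(** A random maximal chain passes through [X] with probability
    [1 / 'C(n, #|X|)]. *)
Lemma card_through X : #|through X| * 'C(n, #|X|) = #|{perm 'I_n}|.
Proof.
have := sum_through (layer n #|X|) setT.
rewrite (eq_bigr (fun=> #|through X|)); last first.
  by move=> Y; rewrite inE => /eqP cY; rewrite setIT; apply: card_through_size.
rewrite sum_nat_const card_layer mulnC => ->.
rewrite (eq_bigr (fun=> 1)) ?sum1_card ?cardsT // => s _.
apply/eqP/cards1P; exists (s @: initial #|X|); apply/setP => Y; rewrite !inE.
apply/andP/eqP => [[/eqP cY /eqP <-]|->]; first by rewrite cY.
by rewrite through_card_imset ?card_set_ord.
Qed.

Lemma through_same_size s X Y :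
  s \in through X -> s \in through Y -> #|X| = #|Y| -> X = Y.
Proof.
rewrite !inE => /eqP <- /eqP <-.
by rewrite !through_card_imset ?card_set_ord // => ->.
Qed.

Lemma card_through_fibre (P : {set {perm 'I_n}}) (Z : {set {set 'I_n}}) k :
    (forall W, W \in Z -> #|W| = k) ->
  \sum_(W in Z) #|through W :&: P| <= #|P|.
Proof.
move=> Zk; rewrite sum_through -sum1_card; apply: leq_sum => s _.
apply/card_le1_eqP => W1 W2; rewrite !inE => /andP[Z1 s1] /andP[Z2 s2].
by apply: (@through_same_size s); rewrite ?inE // !Zk.
Qed.

(** Given that a random chain passes through [Y], it is equally likely to pass
    through any of the subsets of [Y] of a given size. *)
Lemma card_through_below X Y : X \subset Y ->
  'C(#|Y|, #|X|) * #|through X :&: through Y| <= #|through Y|.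
Proof.
move=> XY; rewrite -cards_draws -sum_nat_const.
set Z := [set _ | _ & _]; have Zk W : W \in Z -> #|W| = #|X|.
  by rewrite inE => /andP[_ /eqP].
apply: leq_trans (card_through_fibre (through Y) Zk).
apply: eq_leq; apply: eq_bigr => W WZ; apply: card_through_flag => //.
  by have := WZ; rewrite inE => /andP[].
by rewrite (Zk W).
Qed.

Lemma card_through_above X Y : X \subset Y ->
  'C(n - #|X|, n - #|Y|) * #|through X :&: through Y| <= #|through X|.
Proof.
move=> XY.
pose Z := [set W : {set 'I_n} | (X \subset W) && (#|W| == #|Y|)].
have Zk W : W \in Z -> #|W| = #|Y| by rewrite inE => /andP[_ /eqP].
have <- : #|Z| = 'C(n - #|X|, n - #|Y|).
  have cC (W : {set 'I_n}) : #|~: W| = n - #|W|.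
    by have := cardsC W; rewrite card_ord; lia.
  rewrite -cC -cards_draws -(card_imset _ (inv_inj (@setCK _))).
  apply: eq_card => W; rewrite !inE; apply/imsetP/andP => [[W' + ->]|[WX /eqP cW]].
    by rewrite inE setCS cC => /andP[-> /eqP ->].
  exists (~: W); rewrite ?setCK // inE cC cW subKn ?card_set_ord // eqxx andbT.
  by rewrite -setCS setCK.
rewrite -sum_nat_const.
apply: leq_trans (card_through_fibre (through X) Zk).
apply: eq_leq; apply: eq_bigr => W WZ; rewrite (setIC (through W)).
apply: card_through_flag => //; last by rewrite (Zk W).
by have := WZ; rewrite inE => /andP[].
Qed.

Lemma card_through_pair X Y : X \proper Y -> X != set0 -> Y != setT ->
  n * #|through X :&: through Y| <= 2 * (#|through X| + #|through Y|).
Proof.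
move=> /[dup]/proper_card ltXY /proper_sub XY X0 YT.
have X_gt0 : 0 < #|X| by rewrite card_gt0.
have Y_ltn : #|Y| < n.
  by rewrite -[ltnRHS]card_ord -cardsT proper_card // properT.
have below := card_through_below XY.
have above := card_through_above XY.
have binY : #|Y| <= 'C(#|Y|, #|X|) by apply: leq_bin_interior; rewrite X_gt0.
have binX : n - #|X| <= 'C(n - #|X|, n - #|Y|) by apply: leq_bin_interior; lia.
have := leq_trans (leq_mul binY (leqnn _)) below.
have := leq_trans (leq_mul binX (leqnn _)) above.
(* n <= #|Y| + (n - #|X|), so that one of the two bounds has a factor n / 2. *)
have : n <= #|Y| + (n - #|X|) by lia.
move: #|through X :&: _| #|through X| #|through Y| => p x y le_n px py.
have : n * p <= #|Y| * p + (n - #|X|) * p by rewrite -mulnDl leq_mul2r le_n orbT.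
lia.
Qed.

(** The members of [A] that properly contain [X]. *)
Definition above A X : {set {set 'I_n}} := [set Y in A | X \proper Y].

(** If a chain meets [A], its smallest member in [A] forms a nested pair with each
    of the others. *)
Lemma card_through_chain A s :
  #|[set X in A | s \in through X]| <=
    1 + \sum_(X in A) #|[set Y in above A X | s \in through X :&: through Y]|.
Proof.
set B := [set X in A | _].
have [->|/set0Pn[X1 X1B]] := eqVneq B set0; first by rewrite cards0.
pose X0 := [arg min_(X < X1 in B) #|X|].
have [X0B minX0] : X0 \in B /\ forall X, X \in B -> #|X0| <= #|X|.
  by rewrite /X0; case: arg_minnP.
have /andP[X0A sX0] : (X0 \in A) && (s \in through X0) by have := X0B; rewrite inE.
rewrite (cardsD1 X0) X0B leq_add2l (bigD1 X0) //=.
apply: leq_trans (leq_addr _ _); apply: subset_leq_card; apply/subsetP => X.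
rewrite !inE => /and3P[neX XA sX]; move: sX0; rewrite XA inE => /eqP sX0.
rewrite sX0 sX eqxx !andbT properEneq eq_sym neX -sX0 -(eqP sX) imsetS //.
by rewrite initial_sub // minX0 // inE XA inE.
Qed.

(** The number of members of [A] that are nested with [X]. *)
Definition degree A X := #|[set Y in A | nested X Y]|.

(** Each nested pair is charged to both of its members. *)
Lemma sum_above (f : {set 'I_n} -> nat) A :
  \sum_(X in A) \sum_(Y in above A X) (f X + f Y) = \sum_(X in A) degree A X * f X.
Proof.
have swap : \sum_(X in A) \sum_(Y in above A X) f Y =
    \sum_(Y in A) \sum_(X in A | X \proper Y) f Y.
  under eq_bigr => X _ do under eq_bigl => Y do rewrite inE.
  rewrite (exchange_big_dep [in A]) /=; last by move=> X Y _ /andP[].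
  by apply: eq_bigr => Y YA; apply: eq_bigl => X; rewrite YA.
under eq_bigr => X _ do rewrite big_split /=.
rewrite big_split /= swap -big_split /=; apply: eq_bigr => X XA.
rewrite !sum_nat_const -mulnDl; congr (_ * _).
rewrite -[X in _ + X]cardsE -cardsUI addnC [X in X + _](_ : _ = 0) ?add0n; last first.
  apply/eqP; rewrite cards_eq0 -subset0; apply/subsetP => Y.
  rewrite !inE => /andP[/andP[_ /properP[_ [x xY xX]]]].
  move=> /andP[_ /proper_sub/subsetP/(_ x xY)].
  by rewrite (negbTE xX).
by apply: eq_card => Y; rewrite !inE /nested -andb_orr.
Qed.

Lemma sum_through_family A :
  \sum_(X in A) #|through X| = \sum_s #|[set X in A | s \in through X]|.
Proof.
have := sum_through A setT; under eq_bigr => X _ do rewrite setIT.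
by move=> ->; apply: eq_bigl => s; rewrite inE.
Qed.

(** A form of the Lubell-Yamamoto-Meshalkin inequality for families that need not
    be antichains; the error term accounts for the nested pairs. *)
Lemma lym_with_nested_pairs A :
    set0 \notin A -> setT \notin A ->
  n * \sum_(X in A) #|through X| <=
    n * #|{perm 'I_n}| + 2 * \sum_(X in A) degree A X * #|through X|.
Proof.
move=> A0 AT.
rewrite sum_through_family -sum_above.
pose pairs := \sum_(X in A) \sum_(Y in above A X) #|through X :&: through Y|.
apply: (@leq_trans (n * (#|{perm 'I_n}| + pairs))).
  rewrite leq_mul2l; apply/orP; right.
  apply: leq_trans (leq_sum _ (fun s _ => card_through_chain A s)) _.
  rewrite big_split /= sum1_card leq_add2l exchange_big /=.
  apply: leq_sum => X _.
  under eq_bigr => s _ do rewrite -sum1_card big_mkcond /=.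
  rewrite exchange_big /= [leqRHS]big_mkcond /=; apply: leq_sum => Y _.
  case: ifP => YX; last by rewrite big1 // => s _; rewrite inE YX.
  rewrite -sum1_card [leqRHS]big_mkcond /=; apply: leq_sum => s _.
  by rewrite inE YX andTb.
rewrite mulnDr leq_add2l !big_distrr /=; apply: leq_sum => X XA.
rewrite !big_distrr /=; apply: leq_sum => Y; rewrite inE => /andP[YA XY].
apply: card_through_pair => //; first by apply: contraNneq A0 => <-.
by apply: contraNneq AT => <-.
Qed.

Lemma perm_gt0 : 0 < #|{perm 'I_n}|.
Proof. by apply/card_gt0P; exists 1%g. Qed.

Lemma leq_perm_through X : #|{perm 'I_n}| <= 'C(n, n./2) * #|through X|.
Proof. by rewrite -(card_through X) mulnC leq_mul2r leq_bin_half orbT. Qed.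

Lemma sparse_family_size A :
    set0 \notin A -> setT \notin A ->
    (forall X, X \in A -> 2 * degree A X <= n) ->
  n * #|A| <= n * 'C(n, n./2) + 2 * \sum_(X in A) degree A X.
Proof.
move=> A0 AT deg; set N := 'C(n, _); set M := #|{perm 'I_n}|.
have split_n (f : {set 'I_n} -> nat) : n * \sum_(X in A) f X =
    \sum_(X in A) (n - 2 * degree A X) * f X + 2 * \sum_(X in A) degree A X * f X.
  rewrite !big_distrr -big_split /=; apply: eq_bigr => X XA.
  by rewrite mulnA -mulnDl subnK ?deg.
have excess := lym_with_nested_pairs A0 AT.
rewrite split_n leq_add2r in excess.
have := split_n (fun=> 1); rewrite sum1_card => ->.
under [X in 2 * X]eq_bigr => X _ do rewrite muln1.
rewrite leq_add2r -(leq_pmul2r perm_gt0).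
apply: leq_trans (_ : _ <= N * (n * M)) _; last by rewrite mulnCA mulnA.
apply: leq_trans (leq_mul (leqnn N) excess).
rewrite big_distrl big_distrr /=; apply: leq_sum => X _.
by rewrite muln1 mulnCA leq_mul2l leq_perm_through orbT.
Qed.

Definition antichain A := forall X Y, X \in A -> Y \in A -> ~~ (X \proper Y).

Lemma antichain_through A s : antichain A ->
  #|[set X in A | s \in through X]| <= 1.
Proof.
move=> antiA; apply: leq_trans (card_through_chain A s) _.
rewrite big1 // => X XA; apply/eqP; rewrite cards_eq0 -subset0.
apply/subsetP => Y; rewrite !inE => /andP[/andP[YA]].
by rewrite (negbTE (antiA X Y XA YA)).
Qed.

(** The two steps of Lubell's proof of Sperner's theorem; for a largest antichain
    both are equalities. *)
Lemma through_antichain_sum A : antichain A ->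
  #|A| * #|{perm 'I_n}| <= 'C(n, n./2) * \sum_(X in A) #|through X|
    <= 'C(n, n./2) * #|{perm 'I_n}|.
Proof.
move=> antiA; rewrite -sum_nat_const big_distrr /= leq_sum /=; last first.
  by move=> X _; apply: leq_perm_through.
rewrite -big_distrr /= leq_mul2l sum_through_family -sum1_card; apply/orP; right.
by apply: leq_sum => s _; apply: antichain_through.
Qed.

Lemma sperner A : antichain A -> #|A| <= 'C(n, n./2).
Proof.
move=> /through_antichain_sum/andP[le1 le2].
by rewrite -(leq_pmul2r perm_gt0) (leq_trans le1 le2).
Qed.

Lemma max_antichain_meets_chains A s :
    antichain A -> #|A| = 'C(n, n./2) ->
  exists2 X, X \in A & s \in through X.
Proof.
move=> antiA maxA; have /andP[le1 _] := through_antichain_sum antiA.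
rewrite maxA leq_pmul2l ?bin_gt0 ?(leq_trans (half_leqn n)) // in le1; last first.
  lia.
apply/exists_inP; apply: contraTT le1 => /exists_inPn no_s.
rewrite -ltnNge sum_through_family (bigD1 s) //=.
have -> : #|[set X in A | s \in through X]| = 0.
  apply/eqP; rewrite cards_eq0 -subset0; apply/subsetP => X; rewrite inE.
  by case/andP => /no_s/negbTE ->.
rewrite add0n -cardsT (cardsD1 s) inE add1n ltnS -sum1_card.
rewrite [leqRHS](eq_bigl (predC1 s)); last by move=> t; rewrite !inE andbT.
by apply: leq_sum => t _; apply: antichain_through.
Qed.

Lemma max_antichain_middle A X :
    antichain A -> #|A| = 'C(n, n./2) -> X \in A ->
  #|X| = n./2 \/ #|X| = uphalf n.
Proof.
move=> antiA maxA XA; have /andP[_ le2] := through_antichain_sum antiA.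
have [->|k1] := eqVneq #|X| n./2; first by left.
have [->|k2] := eqVneq #|X| (uphalf n); first by right.
case/negP: (ltnn ('C(n, n./2) * #|{perm 'I_n}|)).
apply: leq_trans le2; rewrite -{1}maxA -sum_nat_const big_distrr /=.
rewrite (bigD1 X) //= [ltnRHS](bigD1 X) //= -addSn; apply: leq_add; last first.
  by apply: leq_sum => Y _; apply: leq_perm_through.
have := perm_gt0; rewrite -(card_through X) muln_gt0 => /andP[X_gt0 _].
by rewrite mulnC ltn_pmul2r // ltn_bin_off_middle.
Qed.

(** In odd dimension, every chain through the swapped set and [b |: X] meets [A],
    on one of the two middle layers; it cannot do so in [b |: X], which contains
    [X]. *)
Lemma max_antichain_swap A X a b :
    antichain A -> #|A| = 'C(n, n./2) -> X \in A -> #|X| = n./2 ->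
    uphalf n = n./2.+1 -> a \in X -> b \notin X ->
  (b |: X) :\ a \in A.
Proof.
move=> antiA maxA XA cX odd_n aX bX.
set W := b |: X; set X' := W :\ a.
have cW : #|W| = n./2.+1 by rewrite cardsU1 bX cX.
have cX' : #|X'| = n./2.
  by have := cardsD1 a W; rewrite cW inE aX orbT => -[].
have [] := @perm_flag (initial n./2) (initial n./2.+1) X' W.
- exact: initial_sub.
- exact: subD1set.
- by rewrite card_initial ?cX' //; lia.
- by rewrite card_initial ?cW //; lia.
move=> s [sX' sW].
have s_X' : s \in through X' by rewrite inE cX' sX'.
have s_W : s \in through W by rewrite inE cW sW.
have [T TA sT] := max_antichain_meets_chains s antiA maxA.
have [cT|cT] := max_antichain_middle antiA maxA TA.
  by rewrite -(through_same_size sT s_X') // cT.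
have eqTW : T = W by apply: (through_same_size sT s_W); rewrite cT cW.
case/negP: (antiA X T XA TA); rewrite eqTW properEcard subsetUr /=.
by rewrite cX cW.
Qed.

Lemma max_antichain_layer A : antichain A -> #|A| = 'C(n, n./2) ->
  A = layer n n./2 \/ A = layer n (uphalf n).
Proof.
move=> antiA maxA.
have full k : 'C(n, k) = 'C(n, n./2) -> (forall X, X \in A -> #|X| = k) ->
    A = layer n k.
  move=> binE Ak; apply/eqP; rewrite eqEcard card_layer maxA binE leqnn andbT.
  by apply/subsetP => X /Ak cX; rewrite inE cX.
have mid X := @max_antichain_middle A X antiA maxA.
have [even_n|odd_n] := eqVneq (uphalf n) n./2.
  by left; apply: full => // X /mid[] ->.
have {}odd_n : uphalf n = n./2.+1 by lia.
case: (boolP [exists X in A, #|X| == n./2]) => [|noX]; last first.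
  right; apply: full; first exact: bin_uphalf.
  move=> X XA; have [cX|//] := mid X XA.
  by case/exists_inP: noX; exists X => //; rewrite cX.
case/exists_inP => X XA /eqP cX; left; apply: full => // Y YA.
have [//|cY] := mid Y YA.
(* Swaps of one element connect the layer, so that A contains all of it. *)
have conn d Z X1 : #|Z :\: X1| = d -> #|Z| = n./2 -> X1 \in A -> #|X1| = n./2 ->
    Z \in A.
  elim: d X1 => [|d IHd] X1 dZ cZ X1A cX1.
    have /eqP : Z :\: X1 == set0 by rewrite -cards_eq0 dZ.
    move/eqP; rewrite setD_eq0 => sub.
    by have /eqP -> : Z == X1 by rewrite eqEcard sub cX1 cZ /=.
  have /card_gt0P[b] : 0 < #|Z :\: X1| by rewrite dZ.
  rewrite inE => /andP[bX1 bZ].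
  have /card_gt0P[a] : 0 < #|X1 :\: Z|.
    have := cardsID Z X1; have := cardsID X1 Z; rewrite setIC cZ cX1 dZ; lia.
  rewrite inE => /andP[aZ aX1].
  have neq_ba : b != a by apply: contraNneq aZ => <-.
  apply: (IHd ((b |: X1) :\ a)) => //.
  - have -> : Z :\: ((b |: X1) :\ a) = (Z :\: X1) :\ b.
      apply/setP => x; rewrite !inE.
      have [->|] := eqVneq x a; rewrite ?(negbTE aZ) ?andbF //=.
      by case: (x == b); case: (x \in X1); case: (x \in Z).
    by have := cardsD1 b (Z :\: X1); rewrite dZ inE bX1 bZ => -[].
  - exact: max_antichain_swap.
  - have := cardsD1 a (b |: X1); rewrite cardsU1 bX1 cX1 !inE aX1 orbT /=; lia.
have /card_gt0P[y yY] : 0 < #|Y| by lia.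
have cZ : #|Y :\ y| = n./2 by have := cardsD1 y Y; rewrite yY; lia.
have ZA := conn _ (Y :\ y) X erefl cZ XA cX.
by case/negP: (antiA _ Y ZA YA); rewrite properD1.
Qed.

Lemma layer_antichain k : antichain (layer n k).
Proof.
move=> X Y; rewrite !inE => /eqP cX /eqP cY; apply/negP => /proper_card.
by rewrite cX cY ltnn.
Qed.

End PermutationChains.

(** * Colourings of a set family *)

(** Bernoulli's inequality, [(1 + 1 / q) ^ k >= 1 + k / q]. *)
Lemma bernoulli_above q k : q ^ k * (q + k) <= q * q.+1 ^ k.
Proof.
elim: k => [|k IHk]; first by rewrite addn0 mul1n muln1.
apply: leq_trans (_ : _ <= q ^ k * (q + k) * q.+1) _.
  by rewrite expnSr -!mulnA leq_mul2l; apply/orP; right; nia.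
by rewrite expnSr mulnA leq_mul2r IHk orbT.
Qed.

(** A weak form of Bernoulli's inequality, [(1 - 1 / (q + 1)) ^ k >= 1 - k / q]. *)
Lemma bernoulli_below q k : q.+1 ^ k * (q - k) <= q ^ k * q.
Proof.
elim: k => [|k IHk]; first by rewrite subn0.
apply: leq_trans (_ : _ <= q.+1 ^ k * (q - k) * q) _.
  by rewrite expnSr -!mulnA leq_mul2l; apply/orP; right; nia.
by rewrite expnSr leq_mul2r IHk orbT.
Qed.

Section Colourings32.

Variables (n : nat) (F : {set {set 'I_n}}).

(** The comparability graph of [F]. *)
Definition member_nested : rel (members F) :=
  fun u v => nested (val u) (val v).

Local Notation e := member_nested.
Local Notation m := #|nonisolated e|.

Lemma member_nested_sym : symmetric e.
Proof. by move=> u v; rewrite /e /nested orbC. Qed.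

Lemma member_nested_irr : irreflexive e.
Proof. by move=> u; rewrite /e /nested properxx. Qed.

Lemma colourings_as_list_colourings : colourings 3 2 F = list_colourings e [ffun => setT].
Proof.
apply/setP => c; rewrite inE; apply/forallP/list_colouringsP => [cP|[_ cP] t].
  split=> [v|u v]; first by rewrite ffunE inE.
  wlog ltuv : u v / val u \proper val v.
    move=> H /orP[uv|vu]; first by apply: H; rewrite // /e /nested uv.
    by rewrite eq_sym; apply: H; rewrite // /e /nested vu.
  move=> _; have := cP [tuple u; v].
  by rewrite /is_chain /= ltuv /= andbT eq_sym.
case/tupleP: t => u t; case/tupleP: t => v t; rewrite (tuple0 t).
apply/implyP; rewrite /is_chain /= !andbT => ltuv.
by rewrite eq_sym cP // /e /nested ltuv.
Qed.

(** The bound required at the leaves of the branching. *)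
Lemma sparse_members_size (D Delta : nat) (A : {set members F}) :
    1 < D -> 1 < n -> D * Delta <= n -> 0 < Delta ->
    (forall v, v \in A -> #|[set u in A | e v u]| < Delta) ->
  D * #|A| <= D * 'C(n, n./2) + 2 * m.
Proof.
move=> D_gt1 n_gt1 Delta_n Delta_gt0 degA; set N := 'C(n, _).
pose B := [set val v | v in A].
have cardB : #|B| = #|A| by rewrite card_imset //; apply: val_inj.
have degB v : degree B (val v) = #|[set u in A | e v u]|.
  rewrite -(card_imset _ val_inj); apply: eq_card => X; rewrite !inE.
  apply/andP/imsetP => [[/imsetP[u uA ->] cuv]|[u + ->]].
    by exists u; rewrite // inE uA.
  by rewrite inE => /andP[uA cuv]; rewrite imset_f.
(* The empty and the full set are nested with every other member, so that in
   their presence the degree condition alone makes the family small. *)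
have extreme v : v \in A -> (forall u, u != v -> e v u) -> #|A| <= N.
  move=> vA all_v; apply: leq_trans (_ : _ <= n) _; last first.
    rewrite /N; apply: leq_trans (leq_bin_half n 1); by rewrite bin1.
  have := degA v vA; rewrite (cardsD1 v A) vA.
  have -> : [set u in A | e v u] = A :\ v.
    apply/setP => u; rewrite !inE andbC.
    have [->|uv] := eqVneq u v; first by rewrite member_nested_irr.
    by rewrite all_v.
  nia.
have [/imsetP[v vA v0]|B0] := boolP (set0 \in B).
  apply: leq_trans (leq_addr _ _); rewrite leq_mul2l (extreme v) ?orbT // => u uv.
  by rewrite /e /nested -v0 proper0 v0 (inj_eq val_inj) uv.
have [/imsetP[v vA vT]|BT] := boolP (setT \in B).
  apply: leq_trans (leq_addr _ _); rewrite leq_mul2l (extreme v) ?orbT // => u uv.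
  by rewrite /e /nested -vT properT vT (inj_eq val_inj) uv orbT.
have := sparse_family_size B0 BT; rewrite cardB => sparse.
have {sparse} : n * #|A| <= n * N + 2 * \sum_(X in B) degree B X.
  apply: sparse => _ /imsetP[v vA ->]; rewrite degB.
  have := degA v vA; nia.
have : \sum_(X in B) degree B X <= Delta * m.
  rewrite big_imset /=; last by move=> u v _ _; apply: val_inj.
  rewrite mulnC -sum_nat_const big_mkcond [leqRHS]big_mkcond /=.
  apply: leq_sum => v _; case: ifP => // vA; rewrite degB.
  case: ifP => vJ; first exact/ltnW/degA.
  rewrite leqn0 cards_eq0 -subset0; apply/subsetP => u; rewrite inE => /andP[_ evu].
  by rewrite in_set0 -vJ inE; apply/existsP; exists u.
case: (leqP #|A| N) => [le_AN _ _|lt_NA].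
  by apply: leq_trans (leq_addr _ _); rewrite leq_mul2l le_AN orbT.
move=> le1 le2.
have le3 : n * (#|A| - N) <= 2 * (Delta * m) by rewrite mulnBr; lia.
have le4 : D * Delta * (#|A| - N) <= n * (#|A| - N) by rewrite leq_mul2r Delta_n orbT.
have : D * (#|A| - N) <= 2 * m.
  rewrite -(leq_pmul2l Delta_gt0).
  apply: leq_trans (leq_trans (leq_trans _ le4) le3) _; lia.
by rewrite mulnBr; lia.
Qed.

Lemma no_nonisolated_antichain : m = 0 <-> antichain F.
Proof.
split=> [m0 X Y XF YF|antiF].
  apply/negP => XY; suff : exist _ X XF \in nonisolated e by rewrite (cards0_eq m0) inE.
  by rewrite inE; apply/existsP; exists (exist _ Y YF); rewrite /e /nested /= XY.
apply/eqP; rewrite cards_eq0 -subset0; apply/subsetP => v; rewrite inE.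
move=> /existsP[u]; rewrite /e /nested.
by rewrite (negbTE (antiF _ _ (valP u) (valP v))) (negbTE (antiF _ _ (valP v) (valP u))).
Qed.

Lemma colourings_32_antichain : antichain F -> #|colourings 3 2 F| = 3 ^ #|F|.
Proof.
move=> antiF; have <- : #|members F| = #|F| by rewrite card_sig.
rewrite colourings_as_list_colourings -[X in X ^ _](card_ord 3) -card_ffun -cardsT.
apply: eq_card => c; rewrite [RHS]inE; apply/list_colouringsP.
split=> [v|u v]; first by rewrite ffunE inE.
rewrite /e /nested.
by rewrite (negbTE (antiF _ _ (valP u) (valP v))) (negbTE (antiF _ _ (valP v) (valP u))).
Qed.

(** The condition [36 * D <= q] gives [((q + 1) / q) ^ (18 D) <= 2], and the bound
    on [n] makes [Delta = n / D] larger than [q ^ 2]. *)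
Lemma colourings_32_not_antichain D q :
    1 < D -> 36 * D <= q -> 2 * (3 ^ 12 * 8 ^ D) < 9 ^ D ->
    D * (q ^ 2).+1 <= n -> 0 < m ->
  #|colourings 3 2 F| < 3 ^ 'C(n, n./2).
Proof.
move=> D_gt1 D_q gainD n_large m_gt0; rewrite colourings_as_list_colourings.
pose Delta := n %/ D; have D_gt0 : 0 < D by exact: ltnW.
have q_gt0 : 0 < q by lia.
have Delta_large : q ^ 2 < Delta by rewrite leq_divRL // mulnC.
have Delta_n : D * Delta <= n by rewrite mulnC leq_divM.
have Delta_gt0 : 0 < Delta by apply: leq_ltn_trans Delta_large.
have n_gt1 : 1 < n.
  by apply: leq_trans Delta_n; apply: leq_trans D_gt1 _; rewrite leq_pmulr.
apply: (@list_colourings_lt _ e member_nested_sym member_nested_irr D Delta _ q).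
- by move=> A degA; apply: sparse_members_size degA.
- exact: Delta_gt0.
- rewrite -(leq_pmul2l q_gt0); apply: leq_trans (bernoulli_above q Delta.-1).
  rewrite -[X in q ^ X](prednK Delta_gt0) expnS mulnA mulnn mulnC.
  by rewrite leq_mul2l; apply/orP; right; lia.
- exact: D_gt0.
- have q_pow : q.+1 ^ (18 * D) <= 2 * q ^ (18 * D).
    have := bernoulli_below q (18 * D).
    move: (q.+1 ^ (18 * D)) (q ^ (18 * D)) => x y le_xy.
    rewrite -(leq_pmul2r q_gt0); apply: leq_trans (_ : _ <= 2 * (x * (q - 18 * D))) _.
      by rewrite mulnCA leq_mul2l; apply/orP; right; lia.
    by rewrite -mulnA leq_mul2l le_xy.
  apply: leq_ltn_trans (leq_mul (leqnn _) q_pow) _.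
  by rewrite mulnA ltn_pmul2r ?expn_gt0 ?q_gt0 // mulnC.
- exact: m_gt0.
Qed.

End Colourings32.

Theorem theorem1p1 :
  exists n0 : nat, forall n : nat, n0 <= n -> forall F : {set {set 'I_n}},
    #|colourings 3 2 F| <= 3 ^ 'C(n, n./2) /\
    (#|colourings 3 2 F| = 3 ^ 'C(n, n./2) <->
     F = layer n n./2 \/ F = layer n (uphalf n)).
Proof.
exists (120 * ((36 * 120) ^ 2).+1) => n n_large F.
have [/no_nonisolated_antichain antiF|] :=
  eqVneq #|nonisolated (@member_nested n F)| 0; last first.
  rewrite -lt0n => m_gt0; have gain : 2 * (3 ^ 12 * 8 ^ 120) < 9 ^ 120 by lia.
  have lt_c := colourings_32_not_antichain (isT : 1 < 120) (leqnn _) gain n_large m_gt0.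
  split; first exact: ltnW.
  split=> [eq_c|layerF]; first by rewrite eq_c ltnn in lt_c.
  have antiF : antichain F by case: layerF => ->; apply: layer_antichain.
  by have /no_nonisolated_antichain m0 := antiF; rewrite m0 in m_gt0.
rewrite colourings_32_antichain // leq_exp2l // sperner //; split=> //.
split=> [/eqP|layerF]; first by rewrite eqn_exp2l // => /eqP; apply: max_antichain_layer.
by case: layerF => ->; rewrite card_layer ?bin_uphalf.
Qed.
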